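(* Let $k\ge1$ be an integer, $n=2k$, $\pi=(1,2)(3,4)\cdots(2k-1,2k)\in S_n$, and let $\tau=((3,4),(3,4),\dots,(3,4))\pi$, an element of order 2 of $S_4\operatorname{wr}S_n$, acting by conjugation on the points of the Fischer space of $Wr(A_4,n)$ (so that $(t.(i,j))^\tau=t^{(3,4)}.(i^\pi,j^\pi)$). Let $H=\langle\tau\rangle$ and $M=M_\eta(Wr(A_4,n))$. Then the fixed subalgebra $M_H$ coincides with the flip subalgebra $A(\tau)$ and has dimension $12k^2-3k$. Among the $\tau$-orbit vectors, there are $6k$ singles $t.(2i-1,2i)$, where $$t\in\{(),(1,2)(3,4),(1,3,4),(2,3,4),(1,4,3),(2,4,3)\}$$ and $1\le i\le k$, and the remaining $12k^2-9k$ vectors are doubles.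
   Context: For a group $T$ all of whose elements have order 1, 2 or 3 and an integer $n\ge 2$, let $T\operatorname{wr}S_n=T^n\rtimes S_n$ be the wreath product, with $S_n$ acting naturally on coordinates; for $t\in T$ let $t_i$ be the image of $t$ in the $i$-th factor of $T^n$. The group $Wr(T,n)$ is the subgroup of $T\operatorname{wr}S_n$ generated by the conjugacy class $D$ (in $T\operatorname{wr}S_n$) of a transposition of $S_n$. One has $D=\{t.(i,j)\mid t\in T, 1\le i<j\le n\}$, where $t.(i,j):=t_it_j^{-1}(i,j)$, with $t.(i,j)=t^{-1}.(j,i)$, and $D$ is a class of 3-transpositions: it is a normal generating set of involutions with $|cd|\le3$ for all $c,d\in D$. Here $T=A_4\le S_4$, and $t^{(3,4)}=(3,4)t(3,4)$. Let $\mathbb{F}$ be a field of characteristic not two and $\eta\in\mathbb{F}\setminus\{0,1\}$. The Matsuo algebra $M_\eta(G,D)$ (also written $M_\eta(G)$) of a 3-transposition group $(G,D)$ is the commutative $\mathbb{F}$-algebra with basis $D$ and product $c\cdot c=c$; $c\cdot d=0$ if $|cd|=2$; $c\cdot d=\frac{\eta}{2}(c+d-c^d)$ if $|cd|=3$. The Fischer space has point set $D$ and lines $\{c,d,c^d\}$ for $c,d\in D$ with $|cd|=3$; its automorphisms act on $M_\eta(G,D)$ by permuting $D$. For a group $H$ of such automorphisms, $M_H=\{u\in M\mid u^h=u\text{ for all }h\in H\}$ is the fixed subalgebra; the orbit vectors $\sum_{c\in O}c$, for $O$ an $H$-orbit on $D$, form a basis of $M_H$. If $H=\langle\tau\rangle$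 with $|\tau|=2$, an orbit vector is a single if it is $a\in D$ with $\{a\}$ an orbit of length 1; a double if it is $a+b$ with $\{a,b\}$ an orbit of length 2 and $a\cdot b=0$; an extra if it is $a+b$ with $\{a,b\}$ an orbit of length 2 and $a\cdot b\neq0$. The flip subalgebra $A(\tau)$ is the subalgebra of $M_H$ generated by all singles and all doubles. *)

(* Defs.v *)
From HB Require Import structures.
From mathcomp Require Import all_boot all_order all_fingroup all_algebra all_solvable.

Set Implicit Arguments.
Unset Strict Implicit.
Unset Printing Implicit Defensive.

Import GroupScope GRing.Theory.

(* Permutations act on the right, (s * t) i = t (s i), and x ^ y = y^-1 * x * y.
   The points 1, ..., n of the mathematical text are the ordinals 0, ..., n.-1. *)

Definition three_transposition_group (gT : finGroupType) (G D : {set gT}) :=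
  [/\ G = <<D>>, D <| G, {in D, forall c, #[c] = 2}
    & {in D &, forall c d, #[c * d] <= 3}].

Section Wreath.

Variables (gT : finGroupType) (n : nat).

Notation base := {dffun forall _ : 'I_n, gT}.

(* The coordinate f i of f is moved to position s i. *)
Definition coord_perm (f : base) (s : 'S_n) : base := [ffun i => f (s^-1 i)].

Fact coord_perm_is_action : is_action [set: 'S_n] coord_perm.
Proof.
split=> [s f g /ffunP eq_fg | f s t _ _]; last first.
  by apply/ffunP=> i; rewrite !ffunE invMg permM.
by apply/ffunP=> i; have := eq_fg (s i); rewrite !ffunE permK.
Qed.
Canonical coord_perm_action := Action coord_perm_is_action.

Fact coord_perm_is_groupAction :
  is_groupAction [set: base] coord_perm_action.
Proof.
move=> s _; rewrite inE; apply/andP; split.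
  by apply/subsetP=> f; rewrite inE.
by apply/morphicP=> f g _ _; apply/ffunP=> i; rewrite !actpermE /= !ffunE.
Qed.
Canonical coord_perm_groupAction := GroupAction coord_perm_is_groupAction.

Definition wreath : finGroupType := sdprod_groupType coord_perm_groupAction.

Definition wbase (f : base) : wreath := sdpair1 coord_perm_groupAction f.
Definition wperm (s : 'S_n) : wreath := sdpair2 coord_perm_groupAction s.

(* t_i *)
Definition wcoord (i : 'I_n) (t : gT) : wreath := wbase (@dfung1 _ (fun=> gT) i t).

(* t.(i,j) *)
Definition wtr (t : gT) (i j : 'I_n) : wreath :=
  wcoord i t * (wcoord j t)^-1 * wperm (tperm i j).

(* T wr S_n as a subgroup of gT wr S_n *)
Definition wreath_sub (T : {group gT}) : {group wreath} :=
  (sdpair1 coord_perm_groupAction @* setXn_group (fun=> T)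
     <*> sdpair2 coord_perm_groupAction @* [set: 'S_n])%G.

(* All the transpositions of S_n are conjugate in T wr S_n, so D is the class
   of any one of them; see wr_class_tperm below. *)
Definition wr_class (T : {group gT}) : {set wreath} :=
  class_support [set wperm (tperm ij.1 ij.2) | ij : 'I_n * 'I_n & ij.1 != ij.2]
                (wreath_sub T).

(* The Matsuo algebra of (Wr T, wr_class T) only depends on the class. *)
Definition Wr (T : {group gT}) : {group wreath} := <<wr_class T>>%G.

End Wreath.

Section WreathTheory.

Variables (gT : finGroupType) (n : nat) (T : {group gT}).

Notation base := {dffun forall _ : 'I_n, gT}.
Implicit Types (f : base) (s : 'S_n) (i j : 'I_n) (t : gT).

Lemma wbaseM : {morph @wbase gT n : f g / f * g}.
Proof. by move=> f g; rewrite /wbase morphM ?inE. Qed.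

Lemma wbaseV : {morph @wbase gT n : f / f^-1}.
Proof. by move=> f; rewrite /wbase morphV ?inE. Qed.

Lemma wpermM : {morph @wperm gT n : s t / s * t}.
Proof. by move=> s t; rewrite /wperm morphM ?inE. Qed.

Lemma wbaseJ f s : wbase f ^ wperm gT s = wbase (coord_perm f s).
Proof. by rewrite /wbase /wperm -sdpair_act ?inE. Qed.

Lemma coord_perm_dfung1 i t s :
  coord_perm (@dfung1 _ (fun=> gT) i t) s = @dfung1 _ (fun=> gT) (s i) t.
Proof.
apply/ffunP=> j; rewrite ffunE; have [<-|ne] := eqVneq (s i) j.
  by rewrite permK !dfung1_id.
by rewrite !dfung1_dflt //; apply: contra_neq ne => ->; rewrite permKV.
Qed.

Lemma wcoordJ i t s : wcoord i t ^ wperm gT s = wcoord (s i) t.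
Proof. by rewrite /wcoord wbaseJ coord_perm_dfung1. Qed.

Lemma wtrJ t i j s : wtr t i j ^ wperm gT s = wtr t (s i) (s j).
Proof.
rewrite /wtr !conjMg conjVg !wcoordJ; congr (_ * _).
by rewrite /wperm -morphJ ?inE // tpermJ.
Qed.

Lemma wtperm_wbase f i j : i != j ->
  wperm gT (tperm i j) ^ wbase f = wtr ((f i)^-1 * f j) i j.
Proof.
move=> ne; set s := tperm i j.
have sV : (wperm gT s)^-1 = wperm gT s by rewrite /wperm -morphV ?inE // tpermV.
have ss : wperm gT s * wperm gT s = 1 by rewrite -{1}sV mulVg.
have -> : wperm gT s ^ wbase f = wbase (f^-1 * coord_perm f s) * wperm gT s.
  by rewrite wbaseM -wbaseJ wbaseV /conjg sV -!mulgA ss mulg1.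
congr (_ * _); rewrite /wcoord -wbaseV -wbaseM; congr wbase.
apply/ffunP=> l; rewrite !ffunE tpermV /s -/(dfung1 _ _).
case: tpermP => [->|->|/eqP nei /eqP nej].
- by rewrite dfwith_in dfwith_out 1?eq_sym // invg1 mulg1.
- by rewrite dfwith_in dfwith_out // mul1g invMg invgK.
by rewrite !dfwith_out 1?eq_sym // mulVg invg1 mulg1.
Qed.

Lemma wreath_subP (x : wreath gT n) :
  reflect (exists2 f : base, (forall i, f i \in T)
             & exists s, x = wbase f * wperm gT s)
          (x \in wreath_sub n T).
Proof.
have nTS : sdpair2 (coord_perm_groupAction gT n) @* [set: 'S_n]
    \subset 'N(sdpair1 (coord_perm_groupAction gT n) @* setXn_group (fun=> T)).
  apply/subsetP=> _ /morphimP[s _ _ ->]; rewrite inE.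
  apply/subsetP=> _ /imsetP[_ /morphimP[f _ fT ->] ->]; move/setXnP: fT => fT.
  rewrite -sdpair_act ?inE // mem_morphim ?inE //.
  by apply/forallP=> i; rewrite ffunE; apply: fT.
rewrite /= norm_joinEr //; apply: (iffP mulsgP) => [[y z] | [f fT [s ->]]].
  case/morphimP=> f _ fT -> {y} /morphimP[s _ _ ->] ->; move/setXnP: fT => fT.
  by exists f => //; exists s.
exists (wbase f) (wperm gT s) => //; last by rewrite mem_morphim ?inE.
by rewrite mem_morphim ?inE //; apply/forallP.
Qed.

Lemma wtperm_wcoord t i j : i != j ->
  wperm gT (tperm i j) ^ wcoord j t = wtr t i j.
Proof.
move=> ne; rewrite wtperm_wbase // dfung1_id.
by rewrite dfung1_dflt 1?eq_sym // invg1 mul1g.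
Qed.

Lemma wcoord_sub i t : t \in T -> wcoord i t \in wreath_sub n T.
Proof.
move=> tT; apply/wreath_subP; exists (@dfung1 _ (fun=> gT) i t).
  by move=> j; rewrite ffunE; case: dfwithP => [|l _].
by exists 1; rewrite /wperm morph1 mulg1.
Qed.

Lemma wperm_sub s : wperm gT s \in wreath_sub n T.
Proof.
apply/wreath_subP; exists 1 => [i|]; first by rewrite ffunE.
by exists s; rewrite /wbase morph1 mul1g.
Qed.

Lemma wr_classP (x : wreath gT n) :
  reflect (exists2 t, t \in T & exists i, exists2 j, i != j & x = wtr t i j)
          (x \in wr_class n T).
Proof.
apply: (iffP imset2P) => [[_ y /imsetP[[i j] /= ne ->] /wreath_subP[f fT [s ->]] ->] | ].
  rewrite inE /= in ne; exists ((f i)^-1 * f j); first by rewrite groupM ?groupV.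
  exists (s i); exists (s j); first by rewrite (inj_eq perm_inj).
  by rewrite conjgM wtperm_wbase // wtrJ.
case=> t tT [i [j ne ->]].
exists (wperm gT (tperm i j)) (wcoord j t); last by rewrite wtperm_wcoord.
  by apply/imsetP; exists (i, j); rewrite ?inE.
exact: wcoord_sub.
Qed.

Lemma wr_class_tperm i j : i != j ->
  wr_class n T = wperm gT (tperm i j) ^: wreath_sub n T.
Proof.
move=> ne; apply/eqP; rewrite eqEsubset; apply/andP; split; last first.
  apply/subsetP=> _ /imsetP[g gW ->]; apply/imset2P.
  exists (wperm gT (tperm i j)) g => //.
  by apply/imsetP; exists (i, j); rewrite ?inE.
apply/subsetP=> _ /wr_classP[t tT [a [b ab ->]]].
pose s := tperm i a * tperm (tperm i a j) b.
have si : s i = a.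
  rewrite permM tpermL tpermD 1?eq_sym //.
  by rewrite -[X in X != _](tpermL i a) (inj_eq perm_inj).
have sj : s j = b by rewrite permM tpermL.
apply/imsetP; exists (wperm gT s * wcoord b t).
  by rewrite groupM ?wcoord_sub ?wperm_sub.
by rewrite conjgM -wtperm_wcoord // /wperm -morphJ ?inE // tpermJ si sj.
Qed.

Lemma wr_class_norm : wreath_sub n T \subset 'N(wr_class n T).
Proof. by apply: class_support_norm. Qed.

Lemma wcoordC i j t r : i != j -> commute (wcoord i t) (wcoord j r : wreath gT n).
Proof.
move=> ne; rewrite /commute -!wbaseM; congr wbase; apply/ffunP=> l; rewrite !mulg_ffun.
have [<-|nl] := eqVneq i l; last by rewrite !(dfung1_dflt _ nl) mulg1 mul1g.
by rewrite !(@dfung1_dflt _ (fun=> gT) j _ i) 1?eq_sym // mulg1 mul1g.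
Qed.

Lemma wcoordX i t m : wcoord i (t ^+ m) = wcoord i t ^+ m :> wreath gT n.
Proof.
elim: m => [|m IH]; first by rewrite !expg0 /wcoord /wbase !morph1.
by rewrite !expgS -IH /wcoord -wbaseM dfung1_morphM.
Qed.

Lemma wcoordV i t : wcoord i t^-1 = (wcoord i t)^-1 :> wreath gT n.
Proof.
rewrite /wcoord -wbaseV; congr wbase.
by apply/ffunP=> l; rewrite !ffunE; case: dfwithP => [|m nm];
   rewrite ?dfwith_in ?dfwith_out ?invg1.
Qed.

Lemma wtrC t i j : i != j -> wtr t i j = wtr t^-1 j i.
Proof.
move=> ne; rewrite /wtr tpermC; congr (_ * _).
by rewrite -!wcoordV invgK wcoordC.
Qed.

Lemma wtr_order t i j : i != j -> #[wtr t i j] = 2.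
Proof.
move=> ne; rewrite -wtperm_wcoord // orderJ /wperm order_injm ?inE ?injm_sdpair2 //.
apply: nt_prime_order => //; first by rewrite expgS expg1 tperm2.
by apply: contra_neq ne => /permP/(_ i); rewrite tpermL perm1.
Qed.

Lemma wr_three_transposition :
  {in T, forall t, #[t] <= 3} ->
  three_transposition_group (Wr n T) (wr_class n T).
Proof.
move=> T3.
have ord3 (x : wreath gT n) m : m.+1 <= 3 -> x ^+ m.+1 = 1 -> #[x] <= 3.
  move=> le3 xm; apply: leq_trans le3; apply: dvdn_leq => //.
  by rewrite order_dvdn xm.
split=> //.
- rewrite /normal subset_gen gen_subG; apply: subset_trans wr_class_norm.
  apply/subsetP=> _ /wr_classP[t tT [i [j ne ->]]].
  by rewrite -wtperm_wcoord // groupJ ?wperm_sub ?wcoord_sub.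
- by move=> _ /wr_classP[t tT [i [j ne ->]]]; apply: wtr_order.
suff tr3 (i j : 'I_n) d : i != j -> d \in wr_class n T -> #[wperm gT (tperm i j) * d] <= 3.
  move=> _ d /wr_classP[t tT [i [j ne ->]]] dD.
  rewrite -wtperm_wcoord // -[d](conjgKV (wcoord j t)) -conjMg orderJ.
  apply: tr3 => //; rewrite memJ_norm // groupV.
  exact: (subsetP wr_class_norm _ (wcoord_sub j tT)).
have share (a b x : 'I_n) r : a != b -> b != x -> x != a ->
    #[wperm gT (tperm a x) * wtr r a b] <= 3.
  move=> ab bx xa; have -> : wperm gT (tperm a x) = wperm gT (tperm a x) ^ wcoord b r.
    rewrite /wcoord wtperm_wbase 1?eq_sym //.
    rewrite (dfung1_dflt _ bx) (dfung1_dflt (i := b)) 1?eq_sym // invg1 mul1g.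
    by rewrite /wtr /wcoord /wbase !morph1 invg1 !mul1g.
  rewrite -wtperm_wcoord // -conjMg orderJ -wpermM; apply: (@ord3 _ 2) => //.
  rewrite /wperm -morphX ?inE // (_ : _ ^+ 3 = 1) ?morph1 //.
  have E : tperm a b * tperm a x * tperm a b = tperm b x.
    by rewrite -{1}(tpermV a b) -mulgA -/(conjg _ _) tpermJ tpermL tpermD // eq_sym.
  have E2 : tperm a x * tperm b x * tperm a x = tperm b a.
    by rewrite -{1}(tpermV a x) -mulgA -/(conjg _ _) tpermJ tpermR tpermD // eq_sym.
  have -> (X Y : 'S_n) : (X * Y) ^+ 3 = X * (Y * X * Y) * X * Y.
    by rewrite !expgS expg0 mulg1 !mulgA.
  by rewrite E E2 tpermC tperm2.
move=> ne /wr_classP[r rT [a [b ab ->]]].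
have dia (x y : 'I_n) t : x != y -> t \in T -> #[wperm gT (tperm x y) * wtr t x y] <= 3.
  move=> xy tT; have -> : wperm gT (tperm x y) * wtr t x y
      = wcoord x t^-1 * wcoord y t.
    have pV : (wperm gT (tperm x y))^-1 = wperm gT (tperm x y).
      by rewrite /wperm -morphV ?inE // tpermV.
    rewrite -wtperm_wcoord // /conjg !mulgA -{1}pV -wcoordV; congr (_ * _).
    by rewrite -mulgA -/(conjg _ _) wcoordJ tpermR.
  have w1 z : wcoord z (1 : gT) = 1 :> wreath gT n.
    by have := wcoordX z 1 0; rewrite !expg0.
  case: #[t] (T3 t tT) (expg_order t) (order_gt0 t) => // m le3 tm _.
  apply: (@ord3 _ m) => //; rewrite expgMn; last exact: wcoordC.
  by rewrite -!wcoordX expgVn tm invg1 !w1 mulg1.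
have [ea|na] := eqVneq a i; have [eb|nb] := eqVneq b j; subst.
- exact: dia.
- by apply: share; rewrite // eq_sym.
- have [ea|nja] := eqVneq a j; first by rewrite ea eqxx in ab.
  by rewrite wtrC // tpermC; apply: share; rewrite // eq_sym.
have [ea|nja] := eqVneq a j; have [eb|nib] := eqVneq b i; subst.
- by rewrite tpermC; apply: dia.
- by rewrite tpermC; apply: share; rewrite // eq_sym.
- by rewrite wtrC //; apply: share; rewrite // eq_sym.
have cm : wtr r a b ^ wperm gT (tperm i j) = wtr r a b.
  by rewrite wtrJ !tpermD // eq_sym.
apply: (@ord3 _ 1%N) => //; rewrite expgMn; last by apply: commute_sym; apply/commgP/conjg_fixP.
rewrite -{2}(wtr_order r ab) expg_order mulg1 expgS expg1 -wpermM tperm2.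
by rewrite /wperm morph1.
Qed.

End WreathTheory.

Section FischerSpace.

Variables (gT : finGroupType) (D : {set gT}).

Notation point := {x : gT | x \in D}.

Definition fischer_line (L : {set point}) : bool :=
  [exists c : point, exists d : point, exists e : point,
    [&& #[val c * val d] == 3, val e == val c ^ val d & L == [set c; d; e]]].

Definition fischer_aut : {set {perm point}} :=
  [set h : {perm point} |
    [forall L : {set point}, fischer_line (h @: L) == fischer_line L]].

(* The subaction 'J^? is trivial outside 'N(D), hence conj_perm g is meaningful
   only when g normalises D. *)
Definition conj_perm (g : gT) : {perm point} := actperm ('J^?) g.

Definition orbits (H : {set {perm point}}) : {set {set point}} :=
  orbit 'P H @: [set: point].

End FischerSpace.

Local Open Scope ring_scope.

Notation matsuo F D := {ffun {x | x \in D} -> F^o}.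

Section Matsuo.

Variables (F : fieldType) (eta : F) (gT : finGroupType) (D : {set gT}).

Notation point := {x : gT | x \in D}.
Notation M := (matsuo F D).

(* The basis vector x of M for x \in D *)
Definition mvec (x : gT) : M := [ffun p => (val p == x)%:R].

(* In a group of 3-transpositions the last case is #[c * d] = 2. *)
Definition mmul_basis (c d : gT) : M :=
  if c == d then mvec c
  else if #[c * d]%g == 3%N then (eta / 2%:R) *: (mvec c + mvec d - mvec (c ^ d)%g)
  else 0.

Definition mmul (u v : M) : M :=
  \sum_(c : point) \sum_(d : point) (u c * v d) *: mmul_basis (val c) (val d).

(* The coefficient u c is moved to the point h c. *)
Definition mact (h : {perm point}) (u : M) : M := [ffun p => u (h^-1%g p)].

Fact mact_is_linear h : linear (mact h).
Proof. by move=> a u v; apply/ffunP=> p; rewrite !ffunE. Qed.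
HB.instance Definition _ h :=
  GRing.isLinear.Build F M M _ (mact h) (mact_is_linear h).

(* M_H *)
Definition fixed_subalgebra (H : {set {perm point}}) : {vspace M} :=
  (\bigcap_(h in H) fixedSpace (linfun (mact h)))%VS.

Lemma fixed_subalgebraP (H : {set {perm point}}) u :
  reflect {in H, forall h, mact h u = u} (u \in fixed_subalgebra H).
Proof.
apply: (iffP idP) => [/subv_bigcapP uH h hH | uH].
  by have /fixedSpaceP := uH h hH; rewrite lfunE.
apply/subv_bigcapP=> h hH; rewrite -memvE.
by apply/fixedSpaceP; rewrite lfunE; apply: uH.
Qed.

Definition orbit_vector (X : {set point}) : M := \sum_(c in X) mvec (val c).

Definition orbit_vectors (H : {set {perm point}}) : seq M :=
  undup [seq orbit_vector X | X <- enum (orbits H)].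

Definition is_single H (v : M) : bool :=
  [exists a : point, ([set a] \in orbits H) && (v == mvec (val a))].

Definition is_double H (v : M) : bool :=
  [exists a : point, exists b : point,
    [&& a != b, [set a; b] \in orbits H, v == mvec (val a) + mvec (val b)
      & mmul (mvec (val a)) (mvec (val b)) == 0]].

Definition is_subalgebra (U : {vspace M}) :=
  {in U &, forall u v, mmul u v \in U}.

Definition generated_subalgebra (S : M -> Prop) (u : M) : Prop :=
  forall U : {vspace M},
    is_subalgebra U -> (forall v, S v -> v \in U) -> u \in U.

(* A(h) *)
Definition flip_subalgebra (h : {perm point}) : M -> Prop :=
  generated_subalgebra (fun v => is_single <[h]> v || is_double <[h]> v).

End Matsuo.

Local Open Scope group_scope.

Section Flip.

Definition pt4 (m : nat) : 'I_4 := inord m.-1.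

(* (a,b) and (a,b,c) in S_4, on the points 1, ..., 4 *)
Definition cyc2 (a b : nat) : 'S_4 := tperm (pt4 a) (pt4 b).
Definition cyc3 (a b c : nat) : 'S_4 := cyc2 a b * cyc2 a c.

Variable k : nat.

Fact pair_fst_subproof (i : 'I_k) : (i.*2 < 2 * k)%N.
Proof. by rewrite mul2n ltn_double. Qed.
Fact pair_snd_subproof (i : 'I_k) : (i.*2.+1 < 2 * k)%N.
Proof. by rewrite mul2n -doubleS leq_double. Qed.

(* 2i-1 and 2i, for i = 1, ..., k *)
Definition pair_fst (i : 'I_k) : 'I_(2 * k) := Ordinal (pair_fst_subproof i).
Definition pair_snd (i : 'I_k) : 'I_(2 * k) := Ordinal (pair_snd_subproof i).

Definition flip_pi : 'S_(2 * k) :=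
  \prod_(i < k) tperm (pair_fst i) (pair_snd i).

Definition flip_tau : wreath 'S_4 (2 * k) :=
  wbase [ffun _ => cyc2 3 4] * wperm _ flip_pi.

Definition D_A4 : {set wreath 'S_4 (2 * k)} := wr_class (2 * k) 'Alt_('I_4).

Definition single_elts : seq 'S_4 :=
  [:: 1; cyc2 1 2 * cyc2 3 4; cyc3 1 3 4; cyc3 2 3 4; cyc3 1 4 3; cyc3 2 4 3].

End Flip.

(* Main.v *)
Require Import Defs.
From mathcomp Require Import all_boot all_order all_fingroup all_algebra all_solvable.
From mathcomp Require Import zify.

Import GroupScope GRing.Theory.

(** The orbit vectors of a group of permutations of D form a basis of its fixed
subspace, so everything about M_H is read off from the orbits of tau on D.  As
tau is an involution, an orbit has one or two points; the orbit of x is a single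
when x is fixed, and a double when x is moved and #[x * x ^ tau] is not 3.
If the value 3 never occurs, all orbit vectors are singles or doubles, hence
A(tau) contains M_H (flip_subalgebra_fixed); the other inclusion holds because
conjugation by tau is an algebra automorphism, so that its fixed space is a
subalgebra.

Let x = t.(i,j).  If {i,j} is not one of the pairs {2l-1,2l}, then x and its
image have disjoint supports, so they commute and their product squares to 1.
If it is, put c = (3,4).  The image of x is (t ^ c)^-1.(i,j), and the product
of x with it has the coordinates t * t ^ c = (t * c)^2 and (c * t)^-2.  Since t
is even, u = t * c is an odd element of S_4, and odd elements of S_4 are
transpositions or 4-cycles, so u ^+ 4 = 1 (odd_S4_exp4) and the product again
squares to 1 (flip_tau_order3).  Moreover x is fixed exactly when t ^ c = t^-1,
which says that u ^+ 2 = 1, i.e. that u is one of the six transpositions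
(odd_S4_involution, mem_single_elts).  This gives 6k fixed points.

Finally D has 12 * 'C(2k, 2) = 24k^2 - 12k points (card_wr_class), and counting
them orbit by orbit gives 6k + 2m for m doubles, whence m = 12k^2 - 9k, and the
dimension is 6k + m. *)

Set Implicit Arguments.
Unset Strict Implicit.
Unset Printing Implicit Defensive.

(** * Orbit vectors and the fixed subspace *)

Section OrbitVectors.
Variables (F : fieldType) (gT : finGroupType) (D : {set gT}).
Notation point := {x : gT | x \in D}.
Local Open Scope ring_scope.

Lemma orbit_vectorE (X : {set point}) p : orbit_vector F X p = (p \in X)%:R.
Proof.
rewrite /orbit_vector sum_ffunE; have [pX|pX] := boolP (p \in X).
  rewrite (bigD1 p) //= ffunE eqxx big1 ?addr0 // => c /andP[_ ne].
  by rewrite ffunE (inj_eq val_inj) eq_sym (negPf ne).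
rewrite big1 // => c cX; rewrite ffunE (inj_eq val_inj).
by case: eqP => // eq_pc; rewrite eq_pc cX in pX.
Qed.

Lemma orbit_vector_inj : injective (@orbit_vector F gT D).
Proof.
move=> X Y eqXY; apply/setP=> p; have := congr1 (fun v : matsuo F D => v p) eqXY.
rewrite /= !orbit_vectorE; case: (p \in X); case: (p \in Y) => //= /eqP.
  by rewrite oner_eq0.
by rewrite eq_sym oner_eq0.
Qed.

Lemma mvec_orbit_vector (a : point) : mvec F D (val a) = orbit_vector F [set a].
Proof. by rewrite /orbit_vector big_set1. Qed.

Lemma mvec_inj : {in D &, injective (mvec F D)}.
Proof.
move=> x y xD yD; rewrite -[x]/(val (Sub x xD : point)) -[y]/(val (Sub y yD : point)).
by rewrite !mvec_orbit_vector => /orbit_vector_inj/set1_inj ->.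
Qed.

Lemma orbits_partition (H : {group {perm point}}) : partition (orbits H) [set: point].
Proof.
apply: orbit_partition; apply/subsetP=> h _; rewrite !inE.
by apply/subsetP=> p; rewrite !inE.
Qed.

Variable H : {group {perm point}}.

Lemma orbit_orbits p : orbit 'P H p \in orbits H.
Proof. by apply/imsetP; exists p; rewrite ?inE. Qed.

Lemma orbits_block X p : X \in orbits H -> p \in X -> X = orbit 'P H p.
Proof. by case/imsetP=> q _ -> /orbit_eqP->. Qed.

Lemma mem_orbit_vectors v :
  reflect (exists2 X, X \in orbits H & v = orbit_vector F X) (v \in orbit_vectors F H).
Proof.
rewrite mem_undup; apply: (iffP mapP) => -[X XH ->]; exists X => //.
  by rewrite mem_enum in XH.
by rewrite mem_enum.
Qed.

Lemma orbit_vectors_map :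
  orbit_vectors F H = [seq orbit_vector F X | X <- enum (orbits H)].
Proof.
by apply: undup_id; rewrite map_inj_uniq ?enum_uniq //; apply: orbit_vector_inj.
Qed.

Lemma fixed_orbitP (u : matsuo F D) :
  reflect (forall p q, q \in orbit 'P H p -> u q = u p) (u \in fixed_subalgebra F H).
Proof.
apply: (iffP (fixed_subalgebraP _ _)) => [uH p _ /orbitP[h hH <-] | uH h hH].
  by rewrite -{1}(uH h hH) ffunE /= /aperm permK.
apply/ffunP=> p; rewrite ffunE; apply: uH; rewrite -[h^-1%g p]/(aperm p h^-1%g).
by rewrite mem_orbit ?groupV.
Qed.

Lemma orbit_vector_fixed X : X \in orbits H -> orbit_vector F X \in fixed_subalgebra F H.
Proof.
move=> /imsetP[r _ ->]; apply/fixed_orbitP=> p q qp; rewrite !orbit_vectorE.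
by congr (_ : bool)%:R; apply: orbit_transl.
Qed.

(** A vector is fixed if and only if it is constant on orbits, i.e. it is the
combination of the orbit vectors whose coefficients are these constants. *)
Lemma fixed_span_orbit_vectors :
  fixed_subalgebra F H = <<orbit_vectors F H>>%VS.
Proof.
apply/eqP; rewrite eqEsubv; apply/andP; split; last first.
  apply/span_subvP=> v /mem_orbit_vectors[X XH ->]; exact: orbit_vector_fixed.
apply/subvP=> u /fixed_orbitP uH.
(* A fixed vector is constant on X; the value 0 is for the empty set only. *)
pose a (X : {set point}) : F := if [pick p in X] is Some p then u p else 0.
have ->: u = \sum_(X in orbits H) a X *: orbit_vector F X.
  apply/ffunP=> q; rewrite sum_ffunE (bigD1 (orbit 'P H q)) ?orbit_orbits //=.
  rewrite ffunE orbit_vectorE orbit_refl big1 => [|X /andP[XH neX]].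
    rewrite addr0 [_ *: _]mulr1 /a; case: pickP => [p /uH-> //|/(_ q)].
    by rewrite orbit_refl.
  rewrite ffunE orbit_vectorE; case: (boolP (q \in X)) => [qX|_].
    by rewrite (orbits_block XH qX) eqxx in neX.
  by rewrite [_ *: _]mulr0.
apply: memv_suml => X XH; apply: memvZ; apply: memv_span.
by apply/mem_orbit_vectors; exists X.
Qed.

(** Distinct orbits are disjoint, so evaluating a linear relation at a point of
an orbit isolates the coefficient of that orbit. *)
Lemma free_orbit_vectors : free (orbit_vectors F H).
Proof.
apply/(@freeP _ _ _ (in_tuple (orbit_vectors F H))) => a sum0 i.
have /mem_orbit_vectors[X XH eqX] : (orbit_vectors F H)`_i \in orbit_vectors F H.
  exact: mem_nth.
have [p pX] : exists p, p \in X.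
  by case/imsetP: XH => p _ ->; exists p; apply: orbit_refl.
have := congr1 (fun v : matsuo F D => v p) sum0.
rewrite /= sum_ffunE (bigD1 i) //= !ffunE eqX orbit_vectorE pX [_ *: _]mulr1.
rewrite big1 ?addr0 // => j ne_ji; rewrite ffunE.
have /mem_orbit_vectors[Y YH eqY] : (orbit_vectors F H)`_j \in orbit_vectors F H.
  exact: mem_nth.
rewrite eqY orbit_vectorE; case: (boolP (p \in Y)) => [pY|_]; last exact: mulr0.
case/eqP: ne_ji; apply/val_inj/eqP.
rewrite -(nth_uniq 0 (ltn_ord j) (ltn_ord i) (undup_uniq _)) eqX eqY.
by rewrite (orbits_block XH pX) (orbits_block YH pY).
Qed.

Lemma dim_fixed_subalgebra : \dim (fixed_subalgebra F H) = size (orbit_vectors F H).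
Proof.
by rewrite fixed_span_orbit_vectors; apply/eqP; rewrite -/(free _) free_orbit_vectors.
Qed.

Lemma is_single_orbit_vector X : X \in orbits H ->
  is_single H (orbit_vector F X) = (#|X| == 1%N).
Proof.
move=> XH; apply/existsP/cards1P=> [[a /andP[_ /eqP]] | [a eqX]].
  by rewrite mvec_orbit_vector => /orbit_vector_inj->; exists a.
by exists a; rewrite -eqX XH mvec_orbit_vector eqX eqxx.
Qed.

End OrbitVectors.

Section Counting.
Variables (F : fieldType) (gT : finGroupType) (D : {set gT}).
Notation point := {x : gT | x \in D}.
Variable H : {group {perm point}}.

(** The orbits partition D, a single accounting for one point and any other
orbit for two. *)
Lemma double_count_orbit_vectors :
  (forall X, X \in orbits H -> #|X| <= 2)%N ->
  (size [seq v <- orbit_vectors F H | is_single H v]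
    + (size [seq v <- orbit_vectors F H | ~~ is_single H v]).*2)%N = #|D|.
Proof.
move=> le2.
have <-: #|[set: point]| = #|D| by rewrite cardsT card_sig.
rewrite (card_partition (orbits_partition H)) -big_enum.
rewrite orbit_vectors_map !size_filter -!sum1_count !big_map -muln2 big_distrl /=.
rewrite [RHS](bigID (fun X => is_single H (orbit_vector F X))) /=.
congr (_ + _)%N; rewrite big_seq_cond [RHS]big_seq_cond; apply: eq_bigr => X;
  rewrite mem_enum => /andP[XH]; rewrite is_single_orbit_vector // => X1.
  by rewrite (eqP X1).
have: (0 < #|X|)%N.
  by case/imsetP: XH => p _ ->; apply/card_gt0P; exists p; apply: orbit_refl.
by have:= le2 X XH; case: #|X| X1 => [|[|[]]].
Qed.
End Counting.

(** * Conjugation acting on the Matsuo algebra *)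

Section Conjugation.
Variables (gT : finGroupType) (D : {set gT}).
Notation point := {x : gT | x \in D}.

(** Normalising D puts g in the domain of the subaction, outside of which
conj_perm is the identity. *)
Lemma val_conj_perm g p : g \in 'N(D) -> val (conj_perm D g p) = val p ^ g.
Proof.
move=> nDg; rewrite /conj_perm actpermE /= val_subact /subact_dom.
suff ->: g \in 'N([set x | x \in D] | 'J) by [].
by rewrite astabsJ; congr (g \in 'N(_)): nDg; apply/setP=> x; rewrite inE.
Qed.

Lemma conj_permK g p : g \in 'N(D) -> conj_perm D g^-1 (conj_perm D g p) = p.
Proof. by move=> nDg; apply: val_inj; rewrite !val_conj_perm ?groupV // conjgK. Qed.

Lemma conj_permV g : g \in 'N(D) -> (conj_perm D g)^-1 = conj_perm D g^-1.
Proof.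
by move=> nDg; apply/permP=> p; rewrite -{1}[p](conj_permK _ (groupVr nDg)) invgK permK.
Qed.

Lemma conj_perm_line g L : g \in 'N(D) -> fischer_line L -> fischer_line (conj_perm D g @: L).
Proof.
move=> nDg /existsP[c /existsP[d /existsP[e /and3P[o3 /eqP eq_e /eqP ->]]]].
apply/existsP; exists (conj_perm D g c); apply/existsP; exists (conj_perm D g d).
apply/existsP; exists (conj_perm D g e).
by rewrite !val_conj_perm // -conjMg orderJ o3 eq_e conjJg eqxx !imsetU !imset_set1 eqxx.
Qed.

Lemma conj_perm_fischer_aut g : g \in 'N(D) -> conj_perm D g \in fischer_aut D.
Proof.
move=> nDg; rewrite inE; apply/forallP=> L; apply/eqP; apply/idP/idP; last exact: conj_perm_line.
move/(conj_perm_line (groupVr nDg)); rewrite -imset_comp.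
by rewrite (@eq_imset _ _ _ id) ?imset_id // => p /=; rewrite conj_permK.
Qed.

Section Algebra.
Variables (F : fieldType) (eta : F).
Local Open Scope ring_scope.

(** When x is not in D, neither is its conjugate, and both sides vanish. *)
Lemma mact_mvec g x : g \in 'N(D)%g ->
  Defs.mact (conj_perm D g) (mvec F D x) = mvec F D (x ^ g)%g.
Proof.
move=> nDg; apply/ffunP=> p; rewrite !ffunE conj_permV // val_conj_perm ?groupV //.
by rewrite -(inj_eq (conjg_inj g)) conjgKV.
Qed.

Lemma mact_mmul_basis g c d : g \in 'N(D)%g ->
  Defs.mact (conj_perm D g) (mmul_basis eta D c d) = mmul_basis eta D (c ^ g)%g (d ^ g)%g.
Proof.
move=> nDg; rewrite /mmul_basis (inj_eq (conjg_inj g)) -conjMg orderJ.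
case: ifP => _; first exact: mact_mvec.
case: ifP => _; last by rewrite linear0.
by rewrite linearZ linearB linearD /= !mact_mvec // conjJg.
Qed.

(** The structure constants only involve orders and conjugates, which
conjugation by g preserves: g acts as an automorphism of the algebra. *)
Lemma mact_mmul g u v : g \in 'N(D)%g ->
  Defs.mact (conj_perm D g) (mmul eta u v) =
  mmul eta (Defs.mact (conj_perm D g) u) (Defs.mact (conj_perm D g) v).
Proof.
move=> nDg; rewrite /mmul linear_sum [RHS](reindex_perm (conj_perm D g)) /=.
apply: eq_bigr => c _; rewrite linear_sum [RHS](reindex_perm (conj_perm D g)) /=.
apply: eq_bigr => d _; rewrite linearZ /= mact_mmul_basis // !val_conj_perm //.
by rewrite !ffunE !permK.
Qed.

Lemma mmul_mvec (c d : point) :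
  mmul eta (mvec F D (val c)) (mvec F D (val d)) = mmul_basis eta D (val c) (val d).
Proof.
rewrite /mmul (bigD1 c) //= (bigD1 d) //= !ffunE !eqxx mulr1 scale1r.
rewrite big1 ?addr0 => [|d' ne]; last first.
  by rewrite !ffunE (inj_eq val_inj) (negPf ne) mulr0 scale0r.
rewrite big1 ?addr0 // => c' ne; rewrite big1 // => d' _.
by rewrite !ffunE (inj_eq val_inj) (negPf ne) mul0r scale0r.
Qed.

Lemma fixed_is_subalgebra (H : {set {perm point}}) :
  {in H, forall h, exists2 g, g \in 'N(D)%g & h = conj_perm D g} ->
  is_subalgebra eta (fixed_subalgebra F H).
Proof.
move=> HD u v /fixed_subalgebraP uH /fixed_subalgebraP vH; apply/fixed_subalgebraP.
by move=> h hH; have [g nDg eq_h] := HD h hH; rewrite eq_h mact_mmul // -eq_h uH ?vH.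
Qed.

End Algebra.

Section Involution.
Variable g : gT.
Hypotheses (nDg : g \in 'N(D)) (g2 : g ^+ 2 = 1).
Let h := conj_perm D g.
Let H : {group {perm point}} := <[h]>%G.

Lemma conj_perm_involution : h ^+ 2 = 1.
Proof.
apply/permP=> p; rewrite expgS expg1 permM perm1 -[RHS](conj_permK _ nDg).
by congr (conj_perm D _ _); rewrite -[RHS]mulg1 -g2 expgS expg1 mulKg.
Qed.

Lemma orbit_conj_perm p : orbit 'P H p = [set p; h p].
Proof.
apply/setP=> q; rewrite !inE; apply/orbitP/orP => [[_ /cycleP[n ->] <-] |].
  rewrite /= /aperm (divn_eq n 2) expgD mulnC expgM conj_perm_involution expg1n mul1g.
  by rewrite modn2; case: (odd n); rewrite ?expg1 ?expg0 ?perm1 eqxx; [right|left].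
by case=> /eqP->; [exists 1; rewrite ?group1 //= /aperm perm1 | exists h; rewrite ?cycle_id].
Qed.

Lemma card_orbit_conj_perm p : (#|orbit 'P H p| == 1%N) = (h p == p).
Proof. by rewrite orbit_conj_perm cards2 [p == _]eq_sym; case: (_ == p). Qed.

Lemma fixed_involution_is_subalgebra (F : fieldType) (eta : F) :
  is_subalgebra eta (fixed_subalgebra F H).
Proof.
apply: fixed_is_subalgebra => _ /cycleP[n ->].
rewrite (divn_eq n 2) expgD mulnC expgM conj_perm_involution expg1n mul1g modn2.
case: (odd n); first by exists g.
exists 1; rewrite ?group1 //; apply/permP=> p; apply: val_inj.
by rewrite val_conj_perm ?group1 // conjg1 perm1.
Qed.

Variables (F : fieldType) (eta : F).
Local Open Scope ring_scope.

Lemma orbit_vector_double p : h p != p -> #[val p * val p ^ g]%g != 3%N ->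
  is_double eta H (orbit_vector F (orbit 'P H p)).
Proof.
move=> ne o3; apply/existsP; exists p; apply/existsP; exists (h p).
rewrite eq_sym ne orbit_conj_perm -orbit_conj_perm orbit_orbits orbit_conj_perm.
rewrite /orbit_vector big_setU1 ?inE 1?eq_sym // big_set1 eqxx /=.
rewrite mmul_mvec /mmul_basis (inj_eq val_inj) [p == _]eq_sym (negPf ne).
by rewrite val_conj_perm // (negPf o3).
Qed.

Lemma card_orbit_involution X : X \in orbits H -> (#|X| <= 2)%N.
Proof.
by case/imsetP=> p _ ->; rewrite orbit_conj_perm cards2; case: (p != _).
Qed.

(** Orbits {a, b} with a b <> 0, the extras, come from points x such that x
and x ^ g have a product of order 3.  Without them, singles and doubles already
span the fixed subspace. *)
Lemma flip_subalgebra_fixed :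
  (forall p : point, #[val p * val p ^ g]%g != 3%N) ->
  forall u, u \in fixed_subalgebra F H <-> flip_subalgebra eta h u.
Proof.
move=> o3 u; split=> [uH U _ sdU | ]; last first.
  (* M_H is a subalgebra that contains the generators of A(h). *)
  apply=> [|v /orP[]]; first exact: fixed_involution_is_subalgebra.
  - case/existsP=> a /andP[aH /eqP->]; rewrite mvec_orbit_vector.
    exact: orbit_vector_fixed.
  case/existsP=> a /existsP[b /and4P[ne abH /eqP-> _]].
  suff ->: mvec F D (val a) + mvec F D (val b) = orbit_vector F [set a; b].
    exact: orbit_vector_fixed.
  by rewrite /orbit_vector big_setU1 ?inE // big_set1.
suff sVU: (fixed_subalgebra F H <= U)%VS by apply: (subvP sVU).
rewrite fixed_span_orbit_vectors; apply/span_subvP=> v /mem_orbit_vectors[_ /imsetP[p _ ->] ->].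
have [hp|ne] := eqVneq (h p) p; apply: sdU; apply/orP; [left | right].
  by rewrite is_single_orbit_vector ?orbit_orbits // orbit_conj_perm hp setUid cards1.
exact: orbit_vector_double.
Qed.

End Involution.
End Conjugation.

(** * The class of transpositions of a wreath product *)

Lemma tperm_eq (T : finType) (i j a b : T) : i != j -> tperm i j = tperm a b ->
  (a = i /\ b = j) \/ (a = j /\ b = i).
Proof.
move=> ne eq_t; have := tpermL i j; have := tpermR i j; rewrite eq_t.
case: tpermP => [->|->|_ _ eq_ij]; last by rewrite eq_ij eqxx in ne.
  by move=> <- _; right.
by move=> <- _; left.
Qed.

Section WreathTranspositions.
Variables (gT : finGroupType) (n : nat).
Implicit Types (s t : gT) (i j a b : 'I_n).

Lemma wbase_inj : injective (@wbase gT n).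
Proof. by move=> f g; apply: (injmP (injm_sdpair1 _)); rewrite inE. Qed.

Lemma wperm_inj : injective (@wperm gT n).
Proof. by move=> p q; apply: (injmP (injm_sdpair2 _)); rewrite inE. Qed.

(** The base group and the symmetric group meet trivially, so the factorisation
of an element of the wreath product is unique. *)
Lemma wbase_wperm_inj (f g : {dffun forall _ : 'I_n, gT}) (p q : 'S_n) :
  wbase f * wperm gT p = wbase g * wperm gT q -> f = g /\ p = q.
Proof.
move=> eq_fp; suff eq_f: wbase f = wbase g.
  by rewrite eq_f in eq_fp; split; [apply: wbase_inj | apply/wperm_inj/(mulgI _ _ _ eq_fp)].
have eq_x : (wbase g)^-1 * wbase f = wperm gT q * (wperm gT p)^-1.
  by apply: (canRL (mulgK _)); rewrite -mulgA eq_fp mulKg.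
apply/eqP; rewrite eq_sym eq_mulVg1 -in_set1 -[[set _]](im_sdpair_TI (coord_perm_groupAction gT n)).
rewrite inE {2}eq_x -wbaseV -wbaseM /wperm -morphV ?inE // -morphM ?inE //.
by rewrite !mem_morphim ?inE.
Qed.

Lemma wcoordM i s t : wcoord i (s * t) = wcoord i s * wcoord i t :> wreath gT n.
Proof. by rewrite /wcoord -wbaseM dfung1_morphM. Qed.

Lemma wcoord1 i : wcoord i 1 = 1 :> wreath gT n.
Proof. by have := wcoordX i (1 : gT) 0; rewrite !expg0. Qed.

(** The only coincidences are t.(i,j) = t^-1.(j,i): the permutation part
determines {i, j}, and the i-th coordinate of the base part then gives t. *)
Lemma wtr_inj s t i j a b : i != j -> wtr s i j = wtr t a b ->
  [/\ a = i, b = j & t = s] \/ [/\ a = j, b = i & t = s^-1].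
Proof.
move=> ne; have aux (r r' : gT) : wtr r i j = wtr r' i j -> r' = r.
  rewrite /wtr /wcoord -!wbaseV -!wbaseM => /wbase_wperm_inj[/ffunP/(_ i)+ _].
  by rewrite !ffunE !dfwith_in !dfwith_out 1?eq_sym // invg1 !mulg1.
move=> eq_w; have [|[ea eb]|[ea eb]] := @tperm_eq _ i j a b ne.
- move: eq_w; rewrite /wtr /wcoord -!wbaseV -!wbaseM.
  by case/wbase_wperm_inj.
- by move: eq_w; rewrite ea eb => eq_w; left; split=> //; apply: aux.
move: eq_w; rewrite ea eb => eq_w; right; split=> //; rewrite -[t]invgK; congr _^-1.
by apply: aux; rewrite eq_w wtrC // eq_sym.
Qed.

Lemma wtr_sqr t i j : i != j -> wtr t i j ^+ 2 = 1.
Proof. by move=> ne; rewrite -(wtr_order t ne) expg_order. Qed.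

(** Moving the first transposition (i,j) to the right swaps the coordinates of
the second factor, and then the two transpositions cancel. *)
Lemma wtr_mul s t i j : i != j ->
  wtr s i j * wtr t i j = wcoord i (s * t^-1) * wcoord j (s^-1 * t).
Proof.
move=> ne; rewrite /wtr -!wcoordV; set P := wperm _ _.
have PV : P^-1 = P by rewrite /P /wperm -morphV ?inE // tpermV.
rewrite -mulgA -{1}PV -/(conjg _ P) conjMg !wcoordJ tpermL tpermR.
rewrite mulgA -[_ * _ * wcoord j t]mulgA -wcoordM -mulgA (wcoordC _ _ (i := j)) 1?eq_sym //.
by rewrite mulgA -wcoordM.
Qed.

Lemma wcoord_wtr_commute s t i j a : a != i -> a != j -> commute (wcoord a t) (wtr s i j).
Proof.
move=> ai aj; rewrite /wtr -wcoordV; apply: commuteM; last first.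
  by apply/commgP/conjg_fixP; rewrite wcoordJ tpermD // eq_sym.
by apply: commuteM; apply: wcoordC.
Qed.

Lemma wtr_commute s t i j a b : a != i -> a != j -> b != i -> b != j ->
  commute (wtr s i j) (wtr t a b).
Proof.
move=> ai aj bi bj; rewrite /(wtr t) -wcoordV; apply: commuteM; last first.
  by apply/commgP/conjg_fixP; rewrite wtrJ !tpermD.
by apply: commuteM; apply/commute_sym/wcoord_wtr_commute.
Qed.

(** A constant element of the base group centralises (i,j), so it only acts on
the coordinate t. *)
Lemma wtrJ_base t (f : {dffun forall _ : 'I_n, gT}) c i j : i != j ->
  (forall l, f l = c) -> wtr t i j ^ wbase f = wtr (t ^ c) i j.
Proof.
move=> ne fc; have eq_c: wcoord j t ^ wbase f = wcoord j (t ^ c).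
  rewrite /wcoord /wbase -morphJ ?inE //; congr (sdpair1 _ _); apply/ffunP=> l.
  rewrite /conjg !ffunE fc.
  by case: (eqVneq j l) => [<-|ne_jl]; rewrite ?dfwith_in // !dfwith_out // mul1g mulVg.
rewrite -!wtperm_wcoord // -conjgM conjgC conjgM eq_c wtperm_wbase // !fc mulVg.
by rewrite /wtr !wcoord1 invg1 !mul1g.
Qed.
End WreathTranspositions.

(** Requiring i < j selects one of the two expressions t.(i,j) = t^-1.(j,i) of
each element. *)
Lemma card_wr_class (gT : finGroupType) (m : nat) (T : {group gT}) :
  #|wr_class m T| = (#|T| * 'C(m, 2))%N.
Proof.
pose P := setX T [set ij : 'I_m * 'I_m | ij.1 < ij.2].
have -> : wr_class m T = (fun x : gT * ('I_m * 'I_m) => wtr x.1 x.2.1 x.2.2) @: P.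
  apply/setP=> x; apply/wr_classP/imsetP=> [[t tT [i [j ne ->]]] | [[t [i j]]]].
    case: (ltngtP i j) => [lt_ij | lt_ji | /val_inj eq_ij].
    - by exists (t, (i, j)); rewrite // !inE tT.
    - by exists (t^-1, (j, i)); rewrite ?inE ?groupV ?tT // wtrC.
    by rewrite eq_ij eqxx in ne.
  rewrite !inE /= => /andP[tT lt_ij ->]; exists t => //; exists i; exists j => //.
  by rewrite -val_eqE /= ltn_eqF.
rewrite card_in_imset => [|[t [i j]] [s [a b]]]; last first.
  rewrite !inE /= => /andP[_ lt_ij] /andP[_ lt_ab] eq_w.
  have ne: i != j by rewrite -val_eqE /= ltn_eqF.
  case: (wtr_inj ne eq_w) => -[ea eb eq_t]; first by rewrite ea eb eq_t.
  by rewrite ea eb ltnNge ltnW in lt_ab.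
rewrite cardsX; congr (_ * _)%N; rewrite -sum1_card.
rewrite (eq_bigl (fun ij : 'I_m * 'I_m => ij.1 < ij.2)) => [|ij]; last by rewrite inE.
rewrite -(pair_big_dep xpredT (fun i j : 'I_m => i < j) (fun _ _ => 1%N)) /=.
rewrite (exchange_big_dep xpredT) //= -bin2_sum big_mkord; apply: eq_bigr => j _.
by rewrite (big_ord_narrow (ltnW (ltn_ord j))) sum1_card card_ord.
Qed.

(** * Odd permutations of four points *)

Section S4.
Implicit Types t u : 'S_4.

(** The cycle lengths of u are at most 4, and all but 3 divide 4.  A cycle of
length 3 would leave a single point, so that u ^+ 3 = 1, which is impossible
because u ^+ 3 is odd with u. *)
Lemma odd_S4_exp4 u : odd_perm u -> u ^+ 4 = 1.
Proof.
move=> odd_u; apply/permP=> i; rewrite perm1.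
pose s := #|porbit u i|.
have us : (u ^+ s) i = i by rewrite permX iter_porbit.
have les4 : s <= 4 by rewrite -[X in _ <= X](card_ord 4); apply: max_card.
have s0 : 0 < s by apply/card_gt0P; exists i; apply: porbit_id.
have fixX m : s %| m -> (u ^+ m) i = i.
  move=> /dvdnP[q ->]; elim: q => [|q IH]; first by rewrite mul0n expg0 perm1.
  by rewrite mulSn expgD permM us.
have [s3|/eqP ns3] := eqVneq s 3; last first.
  by apply: fixX; case: (s) les4 s0 ns3 => [|[|[|[|[|s']]]]].
suff u3 : u ^+ 3 = 1.
  by have := congr1 (@odd_perm _) u3; rewrite !expgS expg0 !odd_permM odd_u odd_perm1.
have fix_orb x : x \in porbit u i -> (u ^+ 3) x = x.
  case/porbitP=> m ->; rewrite -[(u ^+ 3) _]permM -expgD addnC expgD permM.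
  by rewrite (fixX 3) ?s3.
have outside : #|~: porbit u i| = 1%N.
  by apply/eqP; rewrite -(eqn_add2l s) cardsC card_ord s3.
apply/permP=> x; rewrite perm1; have [/fix_orb//|xO] := boolP (x \in porbit u i).
have {outside}/cards1P[y eq_y] : #|~: porbit u i| == 1%N by apply/eqP.
have eq_xy: x = y by apply/set1P; rewrite -eq_y inE.
apply/eqP; rewrite eq_xy -in_set1 -eq_y inE -eq_xy.
(* u ^+ 3 fixes the cycle pointwise, so by injectivity it cannot map x into it. *)
by apply: contra xO => u3O; rewrite -(perm_inj (fix_orb _ u3O)).
Qed.

(** An involution moving a third point c besides a and u a moves all four
points, hence is a product of two transpositions and even. *)
Lemma odd_S4_involution u : odd_perm u -> u ^+ 2 = 1 -> exists a b, a != b /\ u = tperm a b.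
Proof.
move=> odd_u u2; have [a ne_a] : exists a, u a != a.
  apply/existsP; apply: contraLR odd_u; rewrite negb_exists => /forallP u1.
  by rewrite (_ : u = 1) ?odd_perm1 //; apply/permP=> x; rewrite perm1; apply/eqP/negPn/u1.
exists a, (u a); split; first by rewrite eq_sym.
have uu x : u (u x) = x by rewrite -permM -[u * u]expg2 u2 perm1.
set b := u a in ne_a *; have ub : u b = a by apply: uu.
apply/permP=> c; case: tpermP => [->|->|/eqP ca /eqP cb] //.
apply: contraTeq odd_u; set d := u c => ne_dc.
have da : d != a by rewrite -ub (inj_eq perm_inj).
have db : d != b by rewrite (inj_eq perm_inj).
have uniq_abcd : uniq [:: a; b; c; d].
  rewrite /= !inE !negb_or ![a == _]eq_sym ![b == _]eq_sym [c == d]eq_sym.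
  by rewrite [a == b]eq_sym ne_a ca cb da db ne_dc.
have all_abcd : [:: a; b; c; d] =i 'I_4.
  apply/subset_cardP; last exact: subset_predT.
  by rewrite (card_uniqP uniq_abcd) card_ord.
suff ->: u = tperm a b * tperm c d.
  by rewrite odd_permM !odd_tperm [a == b]eq_sym [c == d]eq_sym ne_a ne_dc.
apply/permP=> x; rewrite permM; have := all_abcd x; rewrite !inE.
case/or4P=> /eqP->.
- by rewrite tpermL tpermD.
- by rewrite tpermR tpermD // eq_sym.
- by rewrite [tperm a b c]tpermD 1?eq_sym // tpermL.
by rewrite [tperm a b d]tpermD 1?eq_sym // tpermR; apply: uu.
Qed.

(** The pairs m < n, in the order in which the elements (m,n)(3,4) appear in
single_elts. *)
Definition pairs4 : seq (nat * nat) := [:: (3, 4); (1, 2); (1, 4); (2, 4); (1, 3); (2, 3)]%N.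

Lemma pt4_eq a b : 0 < a <= 4 -> 0 < b <= 4 -> (pt4 a == pt4 b) = (a == b).
Proof. by case: a => [|a] //; case: b => [|b] // a4 b4; rewrite -val_eqE /= !inordK. Qed.

Lemma mem_pairs4 m n : ((m, n) \in pairs4) = [&& 0 < m, m < n & n <= 4].
Proof.
by case: m n => [|[|[|[|m]]]] [|[|[|[|[|n]]]]] //; rewrite /= ?andbF.
Qed.

Lemma single_eltsE :
  single_elts = [seq cyc2 p.1 p.2 * cyc2 3 4 | p <- pairs4].
Proof.
have mulC (x y z : 'I_4) : x != y -> z != y ->
    tperm x y * tperm x z = tperm x z * tperm y z.
  by move=> xy zy; rewrite [LHS]conjgC tpermJ tpermL tpermD // [tperm z y]tpermC.
rewrite /single_elts /cyc3 /cyc2 /= tperm2.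
rewrite (mulC (pt4 1) (pt4 3)) ?pt4_eq // (mulC (pt4 2) (pt4 3)) ?pt4_eq //.
rewrite (mulC (pt4 1) (pt4 4)) ?pt4_eq // (mulC (pt4 2) (pt4 4)) ?pt4_eq //.
by rewrite (tpermC (pt4 4)).
Qed.

Lemma pairs4_neq p : p \in pairs4 -> pt4 p.1 != pt4 p.2.
Proof.
case: p => m n; rewrite mem_pairs4 => /and3P[m0 lt_mn n4] /=.
have [m4 n0] := (leq_trans (ltnW lt_mn) n4, leq_trans m0 (ltnW lt_mn)).
by rewrite pt4_eq ?m0 ?n0 // ltn_eqF.
Qed.

Lemma uniq_single_elts : uniq single_elts.
Proof.
rewrite single_eltsE map_inj_in_uniq // => p q pP qP /mulIg.
move/(tperm_eq (pairs4_neq pP)).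
case: p q pP qP => [m n] [m' n']; rewrite !mem_pairs4 /=.
move=> /and3P[m0 lt_mn n4] /and3P[m0' lt_mn' n4'].
have [m4 m4'] := (leq_trans (ltnW lt_mn) n4, leq_trans (ltnW lt_mn') n4').
have [n0 n0'] := (leq_trans m0 (ltnW lt_mn), leq_trans m0' (ltnW lt_mn')).
case=> -[/eqP + /eqP]; rewrite !pt4_eq ?m0 ?m0' ?n0 ?n0' // => /eqP eq_m /eqP eq_n.
  by rewrite eq_m eq_n.
by rewrite eq_m eq_n ltnNge ltnW in lt_mn'.
Qed.

(** With c = (3,4), the condition t ^ c = t^-1 means that t * c is an involution
or 1; it is odd, hence a transposition. *)
Lemma mem_single_elts t :
  (t \in single_elts) = (t \in 'Alt_('I_4)) && (t ^ cyc2 3 4 == t^-1).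
Proof.
have c2 : cyc2 3 4 * cyc2 3 4 = 1 by apply: tperm2.
have cV : (cyc2 3 4)^-1 = cyc2 3 4 by apply: tpermV.
have odd_c : odd_perm (cyc2 3 4) by rewrite odd_tperm pt4_eq.
rewrite Alt_even single_eltsE; apply/mapP/andP => [[p pP ->] | [t_even /eqP t_inv]].
  rewrite odd_permM odd_c odd_tperm pairs4_neq //; split=> //; apply/eqP.
  by rewrite /conjg -!mulgA c2 mulg1 invMg cV tpermV.
have [a [b [ne_ab eq_t]]] : exists a b, a != b /\ t * cyc2 3 4 = tperm a b.
  apply: odd_S4_involution; first by rewrite odd_permM odd_c addbT.
  by rewrite expg2 -mulgA -{1}cV -/(conjg _ _) t_inv mulgV.
wlog lt_ab: a b ne_ab eq_t / a < b.
  move=> IH; case: (ltngtP a b) => [/IH|/IH|/val_inj/eqP]; rewrite ?(negPf ne_ab) //; first exact.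
  by apply; rewrite 1?eq_sym // tpermC.
exists (a.+1, b.+1).
  by rewrite mem_pairs4 /= ltnS lt_ab ltn_ord.
by rewrite /cyc2 /pt4 /= !inord_val -eq_t -mulgA c2 mulg1.
Qed.
End S4.

(** * The involution tau *)

Section Tau.
Variable k : nat.
Notation n := (2 * k)%N.
Notation D := (D_A4 k).
Notation tau := (flip_tau k).
Notation pi := (flip_pi k).
Notation c34 := (cyc2 3 4).
Implicit Types (t s : 'S_4) (i j : 'I_n).

Lemma pair_fstE (i j : 'I_k) : (pair_fst i == pair_fst j) = (i == j).
Proof. by rewrite -val_eqE /= (inj_eq double_inj). Qed.

Lemma pair_sndE (i j : 'I_k) : (pair_snd i == pair_snd j) = (i == j).
Proof. by rewrite -val_eqE /= eqSS (inj_eq double_inj). Qed.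

Lemma pair_fst_snd (i j : 'I_k) : pair_fst i == pair_snd j = false.
Proof. by rewrite -val_eqE /=; apply/eqP=> /(congr1 odd); rewrite /= !odd_double. Qed.

Lemma flip_pi_act (i : 'I_k) :
  flip_pi k (pair_fst i) = pair_snd i /\ flip_pi k (pair_snd i) = pair_fst i.
Proof.
pose f (l : 'I_k) := tperm (pair_fst l) (pair_snd l).
rewrite (_ : pi = \prod_l f l) //.
have fst_fix (j : 'I_k) : j != i -> f j (pair_fst i) = pair_fst i.
  by move=> ne; rewrite /f tpermD // ?pair_fstE // eq_sym pair_fst_snd.
have snd_fix (j : 'I_k) : j != i -> f j (pair_snd i) = pair_snd i.
  by move=> ne; rewrite /f tpermD // ?pair_sndE // pair_fst_snd.
have := index_enum_uniq 'I_k; have := mem_index_enum i.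
(* The factors before and after the i-th one fix both points of the i-th pair. *)
elim: (index_enum _) => [|j r IH] //=; rewrite inE big_cons !permM.
have [<- _ /andP[ir _] | ne ir /andP[_ ur]] := eqVneq i j; last first.
  by rewrite fst_fix ?snd_fix 1?eq_sym //; apply: IH.
rewrite {1 3}/f tpermL tpermR.
elim: r ir {IH} => [|l r IH]; first by rewrite big_nil !perm1.
rewrite inE negb_or eq_sym => /andP[ne ir].
by rewrite big_cons !permM fst_fix ?snd_fix //; apply: IH.
Qed.

Lemma flip_pi_fst (i : 'I_k) : flip_pi k (pair_fst i) = pair_snd i.
Proof. by case: (flip_pi_act i). Qed.

Lemma flip_pi_snd (i : 'I_k) : flip_pi k (pair_snd i) = pair_fst i.
Proof. by case: (flip_pi_act i). Qed.

Lemma pair_cases i : exists j : 'I_k, i = pair_fst j \/ i = pair_snd j.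
Proof.
have lt : i./2 < k by rewrite ltn_half_double -mul2n.
exists (Ordinal lt).
have := odd_double_half i; case: (odd i) => eq_i; [right | left]; exact/val_inj/esym.
Qed.

Lemma flip_piK i : pi (pi i) = i.
Proof.
by have [j [->|->]] := pair_cases i; rewrite ?flip_pi_fst ?flip_pi_snd ?flip_pi_fst.
Qed.

Lemma flip_pi_neq i : pi i != i.
Proof.
have [j [->|->]] := pair_cases i; rewrite ?flip_pi_fst ?flip_pi_snd ?pair_fst_snd //.
by rewrite eq_sym pair_fst_snd.
Qed.

Lemma wtrJ_flip_tau t i j : i != j -> wtr t i j ^ tau = wtr (t ^ c34) (pi i) (pi j).
Proof.
move=> ne; rewrite conjgM (wtrJ_base _ (c := c34)) ?wtrJ // => l.
by rewrite ffunE.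
Qed.

Lemma flip_tau_sqr : tau ^+ 2 = 1.
Proof.
rewrite /flip_tau; set f := [ffun _ => c34]; rewrite expgMn; last first.
  apply/commgP/conjg_fixP; rewrite wbaseJ; congr wbase.
  by apply/ffunP=> i; rewrite !ffunE.
have ff : f * f = 1 by apply/ffunP=> i; rewrite mulg_ffun oneg_ffun ffunE; apply: tperm2.
have pp : pi * pi = 1 by apply/permP=> i; rewrite permM perm1 flip_piK.
have -> : wbase f ^+ 2 = 1 by rewrite expg2 -wbaseM ff /wbase morph1.
have -> : wperm 'S_4 pi ^+ 2 = 1 by rewrite expg2 -wpermM pp /wperm morph1.
exact: mulg1.
Qed.

Lemma flip_tau_order : 0 < k -> #[tau] = 2.
Proof.
move=> k_gt0; apply: nt_prime_order flip_tau_sqr _ => //; apply/eqP=> tau1.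
have: tau = wbase 1 * wperm 'S_4 1 by rewrite tau1 /wbase /wperm !morph1 mulg1.
case/wbase_wperm_inj=> _ pi1; have := flip_pi_neq (pair_fst (Ordinal k_gt0)).
by rewrite pi1 perm1 eqxx.
Qed.

Lemma flip_tau_norm : tau \in 'N(D).
Proof.
rewrite inE; apply/subsetP=> _ /imsetP[_ /wr_classP[t tA [i [j ne ->]]] ->].
rewrite wtrJ_flip_tau //; apply/wr_classP; exists (t ^ c34).
  by rewrite Alt_even odd_permJ -Alt_even.
by exists (pi i); exists (pi j); rewrite ?(inj_eq perm_inj).
Qed.

Lemma flip_pi_pair i j : i != j -> pi i != j ->
  [/\ pi i != i, pi i != j, pi j != i & pi j != j].
Proof.
move=> ne nij; split; rewrite ?flip_pi_neq //.
by apply: contraNneq nij => <-; rewrite flip_piK.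
Qed.

(** By wtr_inj, the image (t ^ c).(pi i, pi j) can be t.(i,j) in two ways; as
pi i <> i, only the one that exchanges i and j is left. *)
Lemma wtr_flip_fixed t i j : i != j ->
  (wtr t i j ^ tau == wtr t i j) = (pi i == j) && (t ^ c34 == t^-1).
Proof.
move=> ne; rewrite wtrJ_flip_tau //; apply/eqP/andP => [|[/eqP eq_j /eqP->]].
  case/esym/wtr_inj => // -[eq_i eq_j ->]; last by rewrite eq_i !eqxx.
  by case/eqP: (flip_pi_neq i).
by rewrite -eq_j flip_piK -wtrC // eq_j.
Qed.

(** The product squares to 1 in all cases: either its factors commute, or its
square has coordinates (t c)^4 and (c t)^-4 for odd elements of S_4. *)
Lemma flip_tau_order3 x : x \in D -> #[x * x ^ tau] != 3.
Proof.
case/wr_classP=> t tA [i [j ne ->]]; rewrite wtrJ_flip_tau //.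
suff: (wtr t i j * wtr (t ^ c34) (pi i) (pi j)) ^+ 2 = 1.
  by move/eqP; rewrite -order_dvdn; apply: contraTneq => ->.
have [eq_j|nij] := eqVneq (pi i) j; last first.
  have [] := flip_pi_pair ne nij => *.
  rewrite expgMn; last exact: wtr_commute.
  by rewrite !wtr_sqr ?mulg1 ?(inj_eq perm_inj).
have ne' : j != i by rewrite eq_sym.
have odd_c : odd_perm c34 by rewrite odd_tperm pt4_eq.
have cV : c34^-1 = c34 by apply: tpermV.
rewrite -eq_j flip_piK eq_j wtrC // wtr_mul // expgMn; last by apply: wcoordC.
have exp4 (u : 'S_4) : odd_perm u -> u * u * (u * u) = 1.
  by move/odd_S4_exp4; rewrite !expgS expg0 mulg1 !mulgA.
rewrite Alt_even in tA; rewrite -!wcoordX invgK -invMg.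
rewrite (_ : t * t ^ c34 = (t * c34) * (t * c34)); last by rewrite /conjg cV !mulgA.
rewrite (_ : t ^ c34 * t = (c34 * t) * (c34 * t)); last by rewrite /conjg cV !mulgA.
by rewrite expgVn !expg2 !exp4 ?invg1 ?wcoord1 ?mulg1 // odd_permM odd_c (negPf tA).
Qed.

End Tau.

(** * Singles and doubles of tau *)

Section Singles.
Variable k : nat.
Notation n := (2 * k)%N.
Notation D := (D_A4 k).
Notation tau := (flip_tau k).
Notation h := (conj_perm D tau).

Lemma card_D : #|D| = (24 * k ^ 2 - 12 * k)%N.
Proof.
rewrite card_wr_class.
have -> : #|'Alt_('I_4)| = 12%N.
  have := @card_Alt 'I_4; rewrite card_ord => /(_ isT) eq_2A.
  by apply/eqP; rewrite -(@eqn_pmul2l 2) // eq_2A.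
by rewrite bin2 -mulnA mul2n doubleK -mulnn; case: k => // l; nia.
Qed.

Section Field.
Variable F : fieldType.
Local Notation V := (orbit_vectors F <[h]>).

(** A fixed t.(i,j) has j = pi i; when i is the second point of its pair, it is
rewritten as t^-1.(j,i), and single_elts is closed under inversion. *)
Lemma flip_single_vectors (v : matsuo F D) :
  (v \in V) && is_single <[h]> v <->
  exists2 t, t \in single_elts & exists i : 'I_k, v = mvec F D (wtr t (pair_fst i) (pair_snd i)).
Proof.
have nD := flip_tau_norm k; have t2 := flip_tau_sqr k.
have pairN (i : 'I_k) : pair_fst i != pair_snd i by rewrite pair_fst_snd.
split=> [/andP[/mem_orbit_vectors[X XH ->]] | [t tS [i ->]]].
  rewrite is_single_orbit_vector //; case/imsetP: XH => p _ ->.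
  rewrite card_orbit_conj_perm // => /eqP hp.
  rewrite orbit_conj_perm // hp setUid -mvec_orbit_vector.
  have := val_conj_perm p nD; rewrite hp; have := valP p.
  case/wr_classP=> t tA [i [j ne ->]] /esym/eqP; rewrite wtr_flip_fixed //.
  case/andP=> /eqP eq_j t_inv; have [l [eq_i|eq_i]] := pair_cases i.
    exists t; first by rewrite mem_single_elts tA.
    by exists l; rewrite -eq_j eq_i flip_pi_fst.
  exists t^-1; first by rewrite mem_single_elts groupV tA conjVg (inj_eq invg_inj).
  by exists l; rewrite -eq_j eq_i flip_pi_snd wtrC // eq_sym.
move: tS; rewrite mem_single_elts => /andP[tA t_inv].
have xD : wtr t (pair_fst i) (pair_snd i) \in D.
  by apply/wr_classP; exists t => //; exists (pair_fst i); exists (pair_snd i).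
pose p : {x | x \in D} := exist (fun x => x \in D) _ xD.
have hp : h p = p.
  apply: val_inj; rewrite val_conj_perm //=; apply/eqP.
  by rewrite wtr_flip_fixed // flip_pi_fst eqxx.
have orb_p : orbit 'P <[h]> p = [set p] by rewrite orbit_conj_perm // hp setUid.
have pH : [set p] \in orbits <[h]> by rewrite -orb_p orbit_orbits.
rewrite -[wtr _ _ _]/(val p) mvec_orbit_vector is_single_orbit_vector // cards1 eqxx andbT.
by apply/mem_orbit_vectors; exists [set p].
Qed.

(** The elements t.(2l-1,2l) are distinct for distinct (t, l), their indices
being increasing. *)
Lemma size_flip_singles : size [seq v <- V | is_single <[h]> v] = (6 * k)%N.
Proof.
have pairN (i : 'I_k) : pair_fst i != pair_snd i by rewrite pair_fst_snd.
pose S := [seq mvec F D (wtr t (pair_fst i) (pair_snd i)) | t <- single_elts, i <- enum 'I_k].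
have <- : size S = (6 * k)%N by rewrite size_allpairs size_enum_ord.
apply/perm_size/uniq_perm; first by rewrite filter_uniq ?undup_uniq.
  apply: allpairs_uniq; rewrite ?enum_uniq ?uniq_single_elts //.
  move=> _ _ /allpairsP[[t i] [tS _ ->]] /allpairsP[[s j] [sS _ ->]] /=.
  move: tS sS; rewrite ![_.1]/= !mem_single_elts => /andP[tA _] /andP[sA _].
  have inD r l : r \in 'Alt_('I_4) -> wtr r (pair_fst l) (pair_snd l) \in D.
    by move=> rA; apply/wr_classP; exists r => //; exists (pair_fst l); exists (pair_snd l).
  move/(mvec_inj (inD t i tA) (inD s j sA))/(wtr_inj (pairN i)) => -[] [/eqP].
    by rewrite pair_fstE => /eqP-> _ ->.
  by rewrite pair_fst_snd.
move=> v; rewrite mem_filter andbC; apply/idP/allpairsP => [/flip_single_vectors|].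
  by case=> t tS [i ->]; exists (t, i); rewrite mem_enum.
by case=> -[t i] /= [tS _ ->]; apply/flip_single_vectors; exists t => //; exists i.
Qed.

End Field.
End Singles.

Theorem proposition3p13 (F : fieldType) (eta : F) (k : nat) :
  2 \notin [pchar F]%R -> eta != 0%R -> eta != 1%R -> (1 <= k)%N ->
  let D := D_A4 k in
  let tau := flip_tau k in
  let h := conj_perm D tau in
  let H := <[h]> in
  let V := orbit_vectors F H in
  [/\ [/\ #[tau] = 2, tau \in 'N(D), h \in fischer_aut D
        & forall t i j, t \in 'Alt_('I_4) -> i != j ->
            wtr t i j ^ tau = wtr (t ^ cyc2 3 4) (flip_pi k i) (flip_pi k j)],
      (forall u : matsuo F D,
         u \in fixed_subalgebra F H <-> flip_subalgebra eta h u)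
    & \dim (fixed_subalgebra F H) = (12 * k ^ 2 - 3 * k)%N]
  /\
  [/\ (forall v : matsuo F D, (v \in V) && is_single H v <->
         exists2 t, t \in single_elts &
         exists i : 'I_k, v = mvec F D (wtr t (pair_fst i) (pair_snd i))),
      size [seq v <- V | is_single H v] = (6 * k)%N,
      size [seq v <- V | ~~ is_single H v] = (12 * k ^ 2 - 9 * k)%N
    & {in V, forall v, ~~ is_single H v -> is_double eta H v}].
Proof.
move=> _ _ _ k_gt0 D tau h H V.
have le_kk := leq_pmulr k k_gt0.
have nD : tau \in 'N(D) := flip_tau_norm k.
have tau2 : tau ^+ 2 = 1 := flip_tau_sqr k.
have o3 (p : {x | x \in D}) : #[val p * val p ^ tau] != 3.
  by apply: flip_tau_order3; apply: valP.
have sizeS : size [seq v <- V | is_single H v] = (6 * k)%N := size_flip_singles k F.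
have sizeN : size [seq v <- V | ~~ is_single H v] = (12 * k ^ 2 - 9 * k)%N.
  have halve m : (6 * k + m.*2 = 24 * k ^ 2 - 12 * k)%N -> m = (12 * k ^ 2 - 9 * k)%N.
    by rewrite -!mulnn; lia.
  apply: halve; rewrite -card_D -sizeS.
  exact: (double_count_orbit_vectors F (@card_orbit_involution _ _ _ nD tau2)).
split; split=> //.
- split=> //; last by move=> t i j _; apply: wtrJ_flip_tau.
    exact: flip_tau_order.
  exact: conj_perm_fischer_aut.
- exact: flip_subalgebra_fixed.
- rewrite dim_fixed_subalgebra -(count_predC (is_single H)) -!size_filter sizeS.
  rewrite sizeN -mulnn; lia.
- exact: flip_single_vectors.
move=> v /mem_orbit_vectors[X XH ->]; rewrite is_single_orbit_vector //.
case/imsetP: XH => p _ -> nsX; apply: orbit_vector_double => //.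
by apply: contraNneq nsX => hp; rewrite orbit_conj_perm // hp setUid cards1.
Qed.
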